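(* Let $\mathcal F$ be the family of finite non-empty subsets of $\mathbb N$, let $\mathcal M=\prod_{F\in\mathcal F}\mathbb M_{F\cup\{\alpha,\omega\}}$, and let $\phi:\ell^1(\mathbb N)\to\mathcal M$ be the bounded algebra homomorphism ($\ell^1(\mathbb N)$ having pointwise multiplication) determined by $\phi(\delta_j)_F=E_j$ if $j\in F$ and $\phi(\delta_j)_F=0$ if $j\notin F$, where $E_j$ is the rank-one idempotent defined in the context. Let $\tau$ be a faithful, normal, finite, tracial state on $\mathcal M$. Then $$\|\phi(a)\|_{L^1(\tau)}\le 3\|a\|_\infty\qquad\text{for all }a\in\ell^1(\mathbb N).$$ Hence there is a bounded linear map $\theta:c_0(\mathbb N)\to L^1(\mathcal M,\tau)$ such that $\theta(\mathcal G(a))=\iota(\phi(a))$ for all $a\in\ell^1(\mathbb N)$, where $\mathcal G:\ell^1(\mathbb N)\to c_0(\mathbb N)$ is the natural inclusion (which is the Gelfand transform of $\ell^1(\mathbb N)$) and $\iota:\mathcal M\to L^1(\mathcal M,\tau)$ is the canonical inclusion.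
   Context: Here $\alpha,\omega$ are two formal symbols not in $\mathbb N=\{1,2,\dots\}$, and $(\delta_j)_{j\ge1}$ is the standard unit basis of $\ell^1(\mathbb N)$. On $\ell^2(\mathbb N\cup\{\alpha,\omega\})$ with standard basis $e_\alpha,e_\omega,e_1,e_2,\dots$, put $x_n=e_\omega+e_\alpha+e_n$, $y_n=e_\omega-e_\alpha+e_n$ and $E_n(\xi)=\langle \xi,x_n\rangle\,y_n$ for $n\in\mathbb N$; $E_n$ and $E_n^*$ have range in $\operatorname{lin}(e_\alpha,e_\omega,e_n)$. For $F\in\mathcal F$, $\mathbb M_{F\cup\{\alpha,\omega\}}$ is the algebra of complex square matrices indexed by $F\cup\{\alpha,\omega\}$ with the usual $C^*$-norm (acting on $\ell^2(F\cup\{\alpha,\omega\})$); for $j\in F$, $E_j$ is identified with an element of $\mathbb M_{F\cup\{\alpha,\omega\}}$. The product $\prod_F$ is the $\ell^\infty$-direct product (a finite Type I von Neumann algebra): bounded families $(x_F)_F$ with norm $\sup_F\|x_F\|$. $L^1(\mathcal M,\tau)$ (also written $L^1(\tau)$) denotes the completion of $\mathcal M$ with respect to the norm $\|x\|_{L^1(\tau)}=\sup\{|\tau(xy)|: y\in\mathcal M,\ \|y\|\le1\}$. *)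

(* Defs.v *)
From HB Require Import structures.
From mathcomp Require Import all_boot all_order all_algebra.
From mathcomp Require Import finmap.
From mathcomp Require Import spectral.
From mathcomp Require Import complex.
From mathcomp Require Import all_classical all_reals all_analysis.

Set Implicit Arguments.
Unset Strict Implicit.
Unset Printing Implicit Defensive.

Import Order.TTheory GRing.Theory Num.Theory.
Import numFieldNormedType.Exports.
Import Normc.

Local Open Scope classical_set_scope.
Local Open Scope ring_scope.
Local Open Scope complex_scope.
Local Open Scope sesquilinear_scope.

(* The index set of sequences and the ground set of the finite sets F is the
   type nat, standing for {1, 2, ...}: it is only used as a countably infinite
   set of labels. *)
Definition finN : Type := {F : {fset nat} | F != fset0}.

(* F `|` {alpha, omega}, where alpha and omega are two fresh labels *)
Definition label (F : finN) : finType := option (option (val F)).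
Definition lalpha (F : finN) : label F := None.
Definition lomega (F : finN) : label F := Some None.
Definition lnum (F : finN) (n : val F) : label F := Some (Some n).

Section Matrices.
Variable R : realType.
Local Notation C := R[i].

Section OneF.
Variable F : finN.

(* Column vectors and matrices indexed by F `|` {alpha, omega}, the labels being
   numbered by enum_rank. *)
Definition Vec := 'cV[C]_#|label F|.
Definition Mat := 'M[C]_#|label F|.

Definition basis_vec (i : label F) : Vec := delta_mx (enum_rank i) 0.

Definition xvec (n : val F) : Vec :=
  basis_vec (lomega F) + basis_vec (lalpha F) + basis_vec (lnum n).
Definition yvec (n : val F) : Vec :=
  basis_vec (lomega F) - basis_vec (lalpha F) + basis_vec (lnum n).

(* xi |-> <xi, x_n> y_n, the inner product being linear in its first argument *)
Definition Emx (n : val F) : Mat := yvec n *m (xvec n)^t*.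

End OneF.

Definition l2norm n (v : 'cV[C]_n) : R :=
  Num.sqrt (\sum_i normc (v i 0) ^+ 2).

Definition opnorm n (A : 'M[C]_n) : R :=
  sup [set l2norm (A *m v) | v in [set v : 'cV[C]_n | l2norm v <= 1]].

End Matrices.

Section L2theory.
Variables (R : realType).
Local Notation C := R[i].

Lemma normcCE (z : C) : `|z| = (normc z)%:C. Proof. by []. Qed.

Lemma normc_ge0 (z : C) : 0 <= normc z.
Proof. by rewrite -ler0c -normcCE normr_ge0. Qed.

Lemma l2normE n (v : 'cV[C]_n) :
  (l2norm v)%:C = sqrtC (dotmx v^T v^T).
Proof.
have h : (l2norm v)%:C ^+ 2 = dotmx v^T v^T.
  rewrite -rmorphXn/= sqr_sqrtr; last by apply: sumr_ge0 => i _; apply: sqr_ge0.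
  rewrite dotmxE mxE rmorph_sum/=; apply: eq_bigr => i _.
  by rewrite !mxE rmorphXn/= -normcCE normCK.
by rewrite -h sqrCK// ler0c sqrtr_ge0.
Qed.

Lemma l2norm_ge0 n (v : 'cV[C]_n) : 0 <= l2norm v.
Proof. exact: sqrtr_ge0. Qed.

Lemma l2normD n (u v : 'cV[C]_n) : l2norm (u + v) <= l2norm u + l2norm v.
Proof.
rewrite -lecR rmorphD/= !l2normE linearD.
exact: (triangle_lerif (dotmx (n:=n)) u^T v^T).1.
Qed.

Lemma l2normZ n (a : C) (v : 'cV[C]_n) : l2norm (a *: v) = normc a * l2norm v.
Proof.
rewrite /l2norm -[normc a]ger0_norm ?normc_ge0//.
rewrite -sqrtr_sqr -sqrtrM ?sqr_ge0// mulr_sumr; congr Num.sqrt.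
by apply: eq_bigr => i _; rewrite mxE normcM exprMn.
Qed.

Lemma l2norm0 n : l2norm (0 : 'cV[C]_n) = 0.
Proof. by rewrite -[0](scale0r 0) l2normZ normc0 mul0r. Qed.

Lemma l2norm_eq0 n (v : 'cV[C]_n) : l2norm v = 0 -> v = 0.
Proof.
move=> h; apply/colP => i; rewrite mxE.
have s0 : 0 <= \sum_i normc (v i 0) ^+ 2 by apply: sumr_ge0 => j _; apply: sqr_ge0.
have : \sum_i normc (v i 0) ^+ 2 = 0.
  by rewrite -(sqr_sqrtr s0) -/(l2norm v) h expr0n.
move/psumr_eq0P => /(_ (fun j _ => sqr_ge0 _))/(_ i isT)/eqP.
by rewrite sqrf_eq0 => /eqP/eq0_normc.
Qed.

Lemma l2norm_sum n (I : finType) (f : I -> 'cV[C]_n) :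
  l2norm (\sum_i f i) <= \sum_i l2norm (f i).
Proof.
elim/big_ind2: _ => [|x1 x2 y1 y2 h1 h2|//]; first by rewrite l2norm0.
by apply: le_trans (l2normD _ _) _; apply: lerD.
Qed.

Lemma normc_le_l2norm n (v : 'cV[C]_n) i : normc (v i 0) <= l2norm v.
Proof.
rewrite -[normc _]ger0_norm ?normc_ge0//.
rewrite -sqrtr_sqr ler_wsqrtr// (bigD1 i)//= lerDl.
by apply: sumr_ge0 => j _; apply: sqr_ge0.
Qed.

Lemma opnorm_has_sup n (A : 'M[C]_n) :
  has_sup [set l2norm (A *m v) | v in [set v : 'cV[C]_n | l2norm v <= 1]].
Proof.
split; first by exists (l2norm (A *m 0)); exists 0 => //=; rewrite l2norm0.
exists (\sum_i l2norm (col i A)) => _ [v /= v1 <-].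
have -> : A *m v = \sum_i v i 0 *: col i A.
  apply/colP => k; rewrite mxE summxE; apply: eq_bigr => i _.
  by rewrite !mxE mulrC.
apply: le_trans (l2norm_sum _) _; apply: ler_sum => i _.
rewrite l2normZ ler_piMl ?l2norm_ge0//.
exact: le_trans (normc_le_l2norm _ _) v1.
Qed.

Lemma opnorm_ge0 n (A : 'M[C]_n) : 0 <= opnorm A.
Proof.
have [_ ub] := opnorm_has_sup A.
have := ub_le_sup ub; move=> /(_ (l2norm (A *m 0))); rewrite mulmx0 l2norm0.
by apply; exists 0; rewrite /= ?mulmx0 l2norm0.
Qed.

Lemma opnormP n (A : 'M[C]_n) (v : 'cV[C]_n) :
  l2norm (A *m v) <= opnorm A * l2norm v.
Proof.
have [/l2norm_eq0 ->|v0] := eqVneq (l2norm v) 0.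
  by rewrite mulmx0 l2norm0 mulr0.
have vp : 0 < l2norm v by rewrite lt_def v0 l2norm_ge0.
rewrite -ler_pdivrMr//.
have h : normc (l2norm v)^-1%:C = (l2norm v)^-1.
  apply: complexI; rewrite -normcCE ger0_norm// lecR invr_ge0; exact: ltW.
have [_ ub] := opnorm_has_sup A.
apply: (ub_le_sup ub); exists ((l2norm v)^-1%:C *: v) => /=.
  by rewrite l2normZ h mulVf.
by rewrite -scalemxAr l2normZ h mulrC.
Qed.

Lemma opnorm_le n (A : 'M[C]_n) (K : R) : 0 <= K ->
  (forall v, l2norm (A *m v) <= K * l2norm v) -> opnorm A <= K.
Proof.
move=> K0 h; have [ne _] := opnorm_has_sup A.
apply: ge_sup => // _ [v /= v1 <-]; apply: le_trans (h v) _.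
by rewrite ler_piMr.
Qed.

Lemma opnormD n (A B : 'M[C]_n) : opnorm (A + B) <= opnorm A + opnorm B.
Proof.
apply: opnorm_le => [|v]; first by rewrite addr_ge0 ?opnorm_ge0.
rewrite mulmxDl mulrDl; apply: le_trans (l2normD _ _) _.
by apply: lerD; apply: opnormP.
Qed.

Lemma opnormZ n (a : C) (A : 'M[C]_n) : opnorm (a *: A) <= normc a * opnorm A.
Proof.
apply: opnorm_le => [|v]; first by rewrite mulr_ge0 ?normc_ge0 ?opnorm_ge0.
by rewrite -scalemxAl l2normZ -mulrA ler_wpM2l ?normc_ge0// opnormP.
Qed.

Lemma opnormM n (A B : 'M[C]_n) : opnorm (A *m B) <= opnorm A * opnorm B.
Proof.
apply: opnorm_le => [|v]; first by rewrite mulr_ge0 ?opnorm_ge0.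
rewrite -mulmxA -mulrA; apply: le_trans (opnormP _ _) _.
by rewrite ler_wpM2l ?opnorm_ge0// opnormP.
Qed.

Lemma opnorm1 n : opnorm (1%:M : 'M[C]_n) <= 1.
Proof. by apply: opnorm_le => // v; rewrite mul1mx mul1r. Qed.

Lemma dotmx_tr n (u v : 'cV[C]_n) : dotmx u^T v^T = (v^t* *m u) 0 0.
Proof.
by rewrite dotmxE !mxE; apply: eq_bigr => i _; rewrite !mxE mulrC.
Qed.

Lemma opnorm_adj n (A : 'M[C]_n) : opnorm (A^t*) <= opnorm A.
Proof.
apply: opnorm_le => [|v]; first exact: opnorm_ge0.
set w := A^t* *m v.
have [->|w0] := eqVneq (l2norm w) 0; first by rewrite mulr_ge0 ?opnorm_ge0 ?l2norm_ge0.
have wp : 0 < l2norm w by rewrite lt_def w0 l2norm_ge0.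
rewrite -(ler_pM2r wp).
have e : dotmx w^T w^T = dotmx (A *m w)^T v^T.
  by rewrite !dotmx_tr {1}/w trmx_mul map_mxM/= trmxCK -mulmxA.
clearbody w.
have h : (l2norm w)%:C * (l2norm w)%:C <= (l2norm (A *m w))%:C * (l2norm v)%:C.
  rewrite (l2normE w) (l2normE v) (l2normE (A *m w)) -[X in X <= _]expr2.
  rewrite (sqrtCK (dotmx w^T w^T)).
  have /normr_idP <- : 0 <= dotmx w^T w^T by apply: dnorm_ge0.
  rewrite [X in `|X|]e.
  exact: (CauchySchwarz_sqrt (dotmx (n:=n)) (A *m w)^T v^T).1.
rewrite -2!(rmorphM (real_complex R)) lecR in h; apply: le_trans h _.
have := ler_wpM2r (l2norm_ge0 v) (opnormP A w).
by rewrite [X in _ <= X]mulrAC.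
Qed.

End L2theory.

(* The full product of the matrix algebras, without any boundedness condition *)
Definition matfam (R : realType) := forall F : finN, Mat R F.

Section MatfamAlgebra.
Variable R : realType.
Local Notation C := R[i].
Local Notation fam := (matfam R).
Implicit Types x y z : fam.

HB.instance Definition _ := gen_eqMixin fam.
HB.instance Definition _ := gen_choiceMixin fam.

Let zero : fam := fun F => 0.
Let one : fam := fun F => 1%:M.
Let add x y : fam := fun F => x F + y F.
Let opp x : fam := fun F => - x F.
Let mul x y : fam := fun F => x F *m y F.
Let scale (a : C) x : fam := fun F => a *: x F.

Let addA : associative add.
Proof. by move=> x y z; apply: functional_extensionality_dep => F; apply: addrA. Qed.
Let addC : commutative add.
Proof. by move=> x y; apply: functional_extensionality_dep => F; apply: addrC. Qed.
Let add0 : left_id zero add.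
Proof. by move=> x; apply: functional_extensionality_dep => F; apply: add0r. Qed.
Let addN : left_inverse zero opp add.
Proof. by move=> x; apply: functional_extensionality_dep => F; apply: addNr. Qed.

HB.instance Definition _ := GRing.isZmodule.Build fam addA addC add0 addN.

Let mulA : associative mul.
Proof. by move=> x y z; apply: functional_extensionality_dep => F; apply: mulmxA. Qed.
Let mul1 : left_id one mul.
Proof. by move=> x; apply: functional_extensionality_dep => F; apply: mul1mx. Qed.
Let mul1r : right_id one mul.
Proof. by move=> x; apply: functional_extensionality_dep => F; apply: mulmx1. Qed.
Let mulDl : left_distributive mul +%R.
Proof. by move=> x y z; apply: functional_extensionality_dep => F; apply: mulmxDl. Qed.
Let mulDr : right_distributive mul +%R.
Proof. by move=> x y z; apply: functional_extensionality_dep => F; apply: mulmxDr. Qed.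
Let one_neq0 : one != 0.
Proof.
have F0 : (fset1 0%N) != (fset0 : {fset nat}).
  by apply/fset0Pn; exists 0%N; rewrite in_fset1.
pose F : finN := exist (fun F : {fset nat} => is_true (F != fset0)) _ F0.
apply/eqP => /(congr1 (fun x : fam => x F)) /matrixP.
move=> /(_ (enum_rank (lalpha F)) (enum_rank (lalpha F)))/eqP.
by rewrite !mxE eqxx oner_eq0.
Qed.

HB.instance Definition _ :=
  GRing.Zmodule_isNzRing.Build fam mulA mul1 mul1r mulDl mulDr one_neq0.

Let scaleA a b x : scale a (scale b x) = scale (a * b) x.
Proof. by apply: functional_extensionality_dep => F; apply: scalerA. Qed.
Let scale1 : left_id 1 scale.
Proof. by move=> x; apply: functional_extensionality_dep => F; apply: scale1r. Qed.
Let scaleDr : right_distributive scale +%R.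
Proof. by move=> a x y; apply: functional_extensionality_dep => F; apply: scalerDr. Qed.
Let scaleDl x : {morph scale^~ x : a b / a + b}.
Proof. by move=> a b; apply: functional_extensionality_dep => F; apply: scalerDl. Qed.

HB.instance Definition _ :=
  GRing.Zmodule_isLmodule.Build C fam scaleA scale1 scaleDr scaleDl.

Let scaleAl (a : C) x y : a *: (x * y) = (a *: x) * y.
Proof. by apply: functional_extensionality_dep => F; apply: scalemxAl. Qed.
HB.instance Definition _ := GRing.LSemiModule_isLSemiAlgebra.Build C fam scaleAl.

Let scaleAr (a : C) x y : a *: (x * y) = x * (a *: y).
Proof. by apply: functional_extensionality_dep => F; apply: scalemxAr. Qed.
HB.instance Definition _ := GRing.LSemiAlgebra_isSemiAlgebra.Build C fam scaleAr.

Definition bounded_fam : {pred fam} :=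
  fun x => `[< exists K : R, forall F, opnorm (x F) <= K >].

Lemma bounded_famP x :
  reflect (exists K : R, forall F, opnorm (x F) <= K) (x \in bounded_fam).
Proof. exact: asboolP. Qed.

Lemma bounded_fam_subalg : subalg_closed bounded_fam.
Proof.
split=> [|a x y /bounded_famP[K xK] /bounded_famP[M yM]
  |x y /bounded_famP[K xK] /bounded_famP[M yM]]; apply/bounded_famP.
- by exists 1 => F; apply: opnorm1.
- exists (normc a * K + M) => F.
  apply: le_trans (opnormD _ _) _; apply: lerD; last exact: yM.
  by apply: le_trans (opnormZ _ _) _; rewrite ler_wpM2l ?normc_ge0.
- exists (K * M) => F; apply: le_trans (opnormM _ _) _.
  by rewrite ler_pM ?opnorm_ge0.
Qed.

HB.instance Definition _ :=
  GRing.isSubalgClosed.Build C fam bounded_fam bounded_fam_subalg.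

(* The l^oo-direct product of the algebras Mat F *)
Record prodM := ProdM { prodM_fam : matfam R; _ : prodM_fam \in bounded_fam }.
Definition component (x : prodM) (F : finN) : Mat R F := prodM_fam x F.
Coercion component : prodM >-> Funclass.

HB.instance Definition _ := [isSub for prodM_fam].
HB.instance Definition _ := [Choice of prodM by <:].
HB.instance Definition _ := [SubChoice_isSubAlgebra of prodM by <:].

Definition prodM_norm (x : prodM) : R := sup [set opnorm (x F) | F in [set: finN]].

Lemma star_subproof (x : prodM) : (fun F => (x F)^t*) \in bounded_fam.
Proof.
case: x => x /= /bounded_famP[K xK]; apply/bounded_famP; exists K => F.
by apply: le_trans (opnorm_adj _) _.
Qed.

Definition star (x : prodM) : prodM := ProdM (star_subproof x).

End MatfamAlgebra.

Section Traces.
Variable R : realType.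
Local Notation C := R[i].
Local Notation M := (prodM R).

(* The order of the C*-algebra M: an element is positive when it is of the form
   z^* z *)
Definition leM (x y : M) := exists z, y - x = star z * z.

Definition lubM (D : set M) (s : M) :=
  (forall x, D x -> leM x s) /\ forall u, (forall x, D x -> leM x u) -> leM s u.

Definition is_state (tau : {scalar M}) :=
  (forall x, 0 <= tau (star x * x)) /\ tau 1 = 1.

Definition is_faithful (tau : {scalar M}) :=
  forall x, tau (star x * x) = 0 -> x = 0.

Definition is_tracial (tau : {scalar M}) := forall x y, tau (x * y) = tau (y * x).

(* Preservation of the suprema of increasing nets of self-adjoint elements; only
   the range of the net matters, and it is an upward directed set. *)
Definition is_normal (tau : {scalar M}) :=
  forall (D : set M) (s : M), D !=set0 ->
    (forall x, D x -> star x = x) ->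
    (forall x y, D x -> D y -> exists z, [/\ D z, leM x z & leM y z]) ->
    lubM D s ->
    supremums [set tau x | x in D] (tau s).

Definition L1norm (tau : {scalar M}) (x : M) : R :=
  sup [set normc (tau (x * y)) | y in [set y : M | prodM_norm y <= 1]].

(* (L, iota) is a completion of M for the norm L1norm tau: L is complete, and
   iota is a linear isometry with dense range. This determines (L, iota) up to a
   unique isometric isomorphism. *)
Definition L1_completion (tau : {scalar M}) (L : completeNormedModType C)
    (iota : {linear M -> L}) :=
  (forall x, `|iota x| = (L1norm tau x)%:C) /\ dense (range iota).

End Traces.

Section SequenceSpaces.
Variable R : realType.
Local Notation C := R[i].

Definition absolutely_summable : {pred nat -> C} :=
  fun a => `[< cvgn (series (fun n => normc (a n))) >].

Lemma absolutely_summableP a :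
  reflect (cvgn (series (fun n => normc (a n)))) (a \in absolutely_summable).
Proof. exact: asboolP. Qed.

Lemma normcD (x y : C) : normc (x + y) <= normc x + normc y.
Proof. by rewrite -lecR rmorphD/=; exact: (@ler_normD _ C). Qed.

Lemma absolutely_summable_submod : submod_closed absolutely_summable.
Proof.
split=> [|c a b /absolutely_summableP sa /absolutely_summableP sb];
    apply/absolutely_summableP.
  have -> : (fun n => normc ((0 : nat -> C) n)) = 0 by apply/funext => n; apply: normc0.
  rewrite [series _](_ : _ = fun=> 0); first exact: is_cvg_cst.
  by apply/funext => n; rewrite /series/= big1.
apply: (@series_le_cvg _ _ (fun n => normc c * normc (a n) + normc (b n))).
- by move=> n; apply: normc_ge0.
- by move=> n; rewrite addr_ge0 ?mulr_ge0 ?normc_ge0.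
- by move=> n; apply: le_trans (normcD _ _) _; rewrite normcM.
- apply: is_cvg_seriesD => //; exact: is_cvg_seriesZ.
Qed.

HB.instance Definition _ := GRing.isSubmodClosed.Build C (nat -> C)
  absolutely_summable absolutely_summable_submod.

Record l1 := L1seq { l1_seq :> nat -> C; _ : l1_seq \in absolutely_summable }.

HB.instance Definition _ := [isSub for l1_seq].
HB.instance Definition _ := [Choice of l1 by <:].
HB.instance Definition _ := [SubChoice_isSubLmodule of l1 by <:].

Definition l1_norm (a : l1) : R := limn (series (fun n => normc (a n))).

Lemma l1_cvg0 (a : l1) : normc (a n) @[n --> \oo] --> (0 : R).
Proof.
by case: a => a /= /absolutely_summableP /cvg_series_cvg_0.
Qed.

Lemma l1_mul_subproof (a b : l1) : ((a : nat -> C) \* b) \in absolutely_summable.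
Proof.
have := cvgP _ (l1_cvg0 b) => /cvg_seq_bounded [M [_ /(_ (`|M| + 1))]].
have -> : M < `|M| + 1 by apply: le_lt_trans (ler_norm _) _; rewrite ltrDl.
move=> /(_ isT) bM.
case: a => a /= /absolutely_summableP sa; apply/absolutely_summableP.
apply: (@series_le_cvg _ _ (fun n => (`|M| + 1) * normc (a n))).
- by move=> n; apply: normc_ge0.
- by move=> n; rewrite mulr_ge0 ?normc_ge0// addr_ge0.
- move=> n; rewrite normcM mulrC ler_wpM2r ?normc_ge0//.
  by have := bM n I; rewrite /= ger0_norm ?normc_ge0.
- exact: is_cvg_seriesZ.
Qed.

Definition l1_mul (a b : l1) : l1 := L1seq (l1_mul_subproof a b).

Lemma l1_delta_subproof (j : nat) :
  (fun n => (n == j)%:R : C) \in absolutely_summable.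
Proof.
apply/absolutely_summableP/cvg_ex; exists 1.
apply: cvg_near_cst; exists j.+1 => // n /= jn.
rewrite /series/= (bigD1_seq j) ?mem_index_iota ?iota_uniq//= eqxx normc1.
rewrite big1 ?addr0// => i /negbTE ->; exact: normc0.
Qed.

Definition l1_delta (j : nat) : l1 := L1seq (l1_delta_subproof j).

Definition vanishing : {pred nat -> C} :=
  fun a => `[< normc (a n) @[n --> \oo] --> (0 : R) >].

Lemma vanishingP a :
  reflect (normc (a n) @[n --> \oo] --> (0 : R)) (a \in vanishing).
Proof. exact: asboolP. Qed.

Lemma vanishing_submod : submod_closed vanishing.
Proof.
split=> [|c a b /vanishingP sa /vanishingP sb]; apply/vanishingP.
  rewrite [X in X @ _](_ : _ = fun=> 0); first exact: cvg_cst.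
  by apply/funext => n; apply: normc0.
apply: (@squeeze_cvgr _ _ _ _ (fun=> 0) (fun n => normc c * normc (a n) + normc (b n))).
- near=> n; rewrite normc_ge0/=.
  by apply: le_trans (normcD _ _) _; rewrite normcM.
- exact: cvg_cst.
- rewrite -[X in _ --> X]addr0 -[X in X + _](mulr0 (normc c)).
  by apply: cvgD => //; apply: cvgMr.
Unshelve. all: by end_near.
Qed.

HB.instance Definition _ := GRing.isSubmodClosed.Build C (nat -> C)
  vanishing vanishing_submod.

Record c0 := C0seq { c0_seq :> nat -> C; _ : c0_seq \in vanishing }.

HB.instance Definition _ := [isSub for c0_seq].
HB.instance Definition _ := [Choice of c0 by <:].
HB.instance Definition _ := [SubChoice_isSubLmodule of c0 by <:].

Definition sup_norm (a : nat -> C) : R := sup [set normc (a n) | n in [set: nat]].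

Lemma gelfand_subproof (a : l1) : (a : nat -> C) \in vanishing.
Proof. exact/vanishingP/l1_cvg0. Qed.

(* The Gelfand transform of l^1 is its inclusion in c_0 *)
Definition gelfand (a : l1) : c0 := C0seq (gelfand_subproof a).

End SequenceSpaces.

(* The conditions that determine phi are satisfiable: the witness is
   a |-> (\sum_(j in F) a_j E_j)_F. *)
Section PhiExists.
Variable R : realType.
Local Notation C := R[i].

Section OneF.
Variable F : finN.

Lemma xvecE (n : val F) (s : label F) :
  xvec R n (enum_rank s) 0 =
  (s == lomega F)%:R + (s == lalpha F)%:R + (s == lnum n)%:R.
Proof. by rewrite !mxE !andbT !(inj_eq enum_rank_inj). Qed.

Lemma yvecE (n : val F) (s : label F) :
  yvec R n (enum_rank s) 0 =
  (s == lomega F)%:R - (s == lalpha F)%:R + (s == lnum n)%:R.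
Proof. by rewrite !mxE !andbT !(inj_eq enum_rank_inj). Qed.

Lemma xy_dot (j k : val F) : (xvec R j)^t* *m yvec R k = ((j == k)%:R)%:M.
Proof.
rewrite /xvec /yvec !raddfD/= !mulmxN.
rewrite !mulmxDl.
have d (s t : label F) : (basis_vec R s)^t* *m basis_vec R t = ((s == t)%:R)%:M.
  rewrite /basis_vec trmx_delta map_delta_mx mul_delta_mx_cond (inj_eq enum_rank_inj).
  apply/matrixP => a b; rewrite !ord1 !mxE; case: eqP => _; rewrite !mxE ?eqxx//.
rewrite !d !eqxx /= (_ : (lnum j == lnum k) = (j == k)) //.
have z : 0%:M = 0 :> 'M[C]_1 by apply: raddf0.
by rewrite !z !addr0 !add0r subrr add0r.
Qed.

Lemma EmxM (j k : val F) : Emx R j *m Emx R k = if j == k then Emx R j else 0.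
Proof.
rewrite /Emx mulmxA -(mulmxA (yvec R j)) xy_dot mul_mx_scalar.
by case: eqP => [->|_]; rewrite ?scale1r// scale0r mul0mx.
Qed.

Lemma l2norm_basis (s : label F) : l2norm (basis_vec R s) <= 1.
Proof.
have n0 : normc (0 : C) = 0 by apply: normc0.
have n1 : normc (1 : C) = 1 by apply: normc1.
rewrite /l2norm (bigD1 (enum_rank s))//= big1 => [|i ne].
  by rewrite mxE !eqxx n1 expr1n addr0 sqrtr1.
rewrite mxE (negbTE ne) (_ : normc _ = 0) ?expr0n//; apply: n0.
Qed.

Lemma opnorm_Emx (j : val F) : opnorm (Emx R j) <= 9.
Proof.
have n1 : normc (-1 : C) = 1 by rewrite normcN; apply: normc1.
have lx : l2norm (xvec R j) <= 3.
  apply: le_trans (l2normD _ _) _; rewrite [leRHS](natrD _ 2 1).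
  apply: (lerD _ (l2norm_basis _)); apply: le_trans (l2normD _ _) _.
  by rewrite [leRHS](natrD _ 1 1); apply: lerD; apply: l2norm_basis.
have ly : l2norm (yvec R j) <= 3.
  apply: le_trans (l2normD _ _) _; rewrite [leRHS](natrD _ 2 1).
  apply: (lerD _ (l2norm_basis _)); apply: le_trans (l2normD _ _) _.
  rewrite -scaleN1r l2normZ n1 mul1r.
  by rewrite [leRHS](natrD _ 1 1); apply: lerD; apply: l2norm_basis.
apply: opnorm_le => // v; rewrite /Emx -mulmxA.
have -> : (xvec R j)^t* *m v = (dotmx v^T (xvec R j)^T)%:M.
  by apply/matrixP => a b; rewrite !ord1 [RHS]mxE eqxx mulr1n dotmx_tr.
rewrite mul_mx_scalar l2normZ.
have h : normc (dotmx v^T (xvec R j)^T) <= l2norm v * l2norm (xvec R j).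
  have : `|dotmx v^T (xvec R j)^T| <= (l2norm v)%:C * (l2norm (xvec R j))%:C.
    rewrite (l2normE v) (l2normE (xvec R j)).
    exact: (CauchySchwarz_sqrt (dotmx (n:=_)) v^T (xvec R j)^T).1.
  by rewrite -[leRHS](rmorphM (real_complex R)) normcCE lecR.
apply: le_trans (ler_pM (normc_ge0 _) (l2norm_ge0 _) h ly) _.
rewrite -mulrA [leRHS]mulrC ler_wpM2l ?l2norm_ge0//.
rewrite [leRHS](natrM _ 3 3).
by rewrite ler_pM ?l2norm_ge0.
Qed.

End OneF.

Definition phi_fam (a : l1 R) : matfam R :=
  fun F => \sum_(j : val F) a (val j) *: Emx R j.

Lemma phi_fam_bound (a : l1 R) (F : finN) : opnorm (phi_fam a F) <= 9 * l1_norm a.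
Proof.
rewrite /phi_fam.
have h : opnorm (\sum_(j : val F) a (val j) *: Emx R j) <= \sum_(j : val F) 9 * normc (a (val j)).
  elim/big_ind2: _ => [|x1 x2 y1 y2 h1 h2|j _].
  - by apply: opnorm_le => // v; rewrite mul0mx l2norm0 mul0r.
  - by apply: le_trans (opnormD _ _) _; apply: lerD.
  - apply: le_trans (opnormZ _ _) _; rewrite mulrC ler_wpM2r ?normc_ge0//.
    exact: opnorm_Emx.
apply: le_trans h _; rewrite -mulr_sumr ler_wpM2l//.
rewrite -(big_seq_fsetE _ _ xpredT (fun k => normc (a k)))/=.
pose N := (\max_(k <- val F) k).+1.
have sc : cvgn (series (fun n => normc (a n))).
  by case: a => a /= /absolutely_summableP.
apply: (@le_trans _ _ (series (fun n => normc (a n)) N)).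
  rewrite /series/=.
  rewrite [leRHS](bigID (fun k => k \in val F))/= -[leLHS]addr0 lerD//; last first.
    by apply: sumr_ge0 => *; apply: normc_ge0.
  rewrite -[leRHS]big_filter.
  suff p : perm_eq (val F) [seq k <- index_iota 0 N | k \in val F].
    by rewrite (perm_big _ p).
  apply: uniq_perm; rewrite ?fset_uniq ?filter_uniq ?iota_uniq// => k.
  rewrite mem_filter mem_index_iota/=.
  case: (boolP (k \in _)) => //= kF; rewrite /N ltnS.
  by rewrite (big_rem k kF) /= leq_maxl.
apply: nondecreasing_cvgn_le => //.
by apply: nondecreasing_series => n _ _; apply: normc_ge0.
Qed.

Lemma phi_subproof (a : l1 R) : phi_fam a \in @bounded_fam R.
Proof. by apply/bounded_famP; exists (9 * l1_norm a) => F; apply: phi_fam_bound. Qed.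

Definition phi0 (a : l1 R) : prodM R := ProdM (phi_subproof a).

Lemma phi_linear : linear phi0.
Proof.
move=> c a b; apply: val_inj; apply: functional_extensionality_dep => F.
rewrite [RHS](_ : _ = c *: phi_fam a F + phi_fam b F)//.
rewrite [LHS](_ : _ = phi_fam (c *: a + b) F)// /phi_fam.
rewrite scaler_sumr -big_split/=; apply: eq_bigr => j _.
by rewrite scalerA -scalerDl.
Qed.

HB.instance Definition _ := GRing.isLinear.Build C (l1 R) (prodM R) _ phi0 phi_linear.

Lemma phi_exists : exists phi : {linear l1 R -> prodM R},
  [/\ forall a b, phi (l1_mul a b) = phi a * phi b,
      exists K : R, forall a : l1 R, prodM_norm (phi a) <= K * l1_norm a,
      forall (F : finN) (j : nat) (jF : j \in val F),
        phi (l1_delta R j) F = Emx R [` jF]%fset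
    & forall (F : finN) (j : nat), j \notin val F ->
        phi (l1_delta R j) F = 0].
Proof.
exists phi0; split.
- move=> a b; apply: val_inj; apply: functional_extensionality_dep => F.
  rewrite [RHS](_ : _ = phi_fam a F *m phi_fam b F)//.
  rewrite [LHS](_ : _ = phi_fam (l1_mul a b) F)// /phi_fam.
  rewrite mulmx_suml; apply: eq_bigr => j _.
  rewrite mulmx_sumr (bigD1 j)//= big1 ?addr0 => [|k kj].
    by rewrite -scalemxAl -scalemxAr EmxM eqxx scalerA.
  by rewrite -scalemxAl -scalemxAr EmxM eq_sym (negbTE kj) !scaler0.
- exists 9 => a; apply: ge_sup; last by move=> _ [F _ <-]; apply: phi_fam_bound.
  have F0 : (fset1 0%N) != (fset0 : {fset nat}).
    by apply/fset0Pn; exists 0%N; rewrite in_fset1.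
  by eexists; exists (exist (fun F : {fset nat} => is_true (F != fset0)) _ F0).
- move=> F j jF; rewrite [LHS](_ : _ = phi_fam (l1_delta R j) F)// /phi_fam.
  rewrite (bigD1 [` jF]%fset)//= eqxx scale1r big1 ?addr0// => k kj.
  have -> : (val k == j) = false by apply/negbTE; apply: contra kj => /eqP e; apply/eqP/val_inj.
  by rewrite scale0r.
- move=> F j jF; rewrite [LHS](_ : _ = phi_fam (l1_delta R j) F)// /phi_fam.
  rewrite big1// => k _ /=.
  have -> : (val k == j) = false by apply/negbTE; apply: contra jF => /eqP <-; apply: valP.
  by rewrite scale0r.
Qed.
End PhiExists.

(* Main.v *)
(* Write x_j^* and y_j for the functional and the vector with E_j = y_j x_j^*.
   By normality, tau is the limit of its cut-offs to finitely many blocks, and on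
   the block of F it is a nonnegative multiple c_F Tr of the matrix trace, with
   \sum_F c_F (|F| + 2) = 1. On that block, for |y| <= 1,
     |Tr (\sum_(j in F) a_j E_j y)| = |\sum_(j in F) a_j <y y_j, x_j>|
       <= |F| |a|_oo |x_j| |y_j| = 3 |F| |a|_oo <= 3 (|F| + 2) |a|_oo,
   whence the bound 3 |a|_oo after summation over F. The map theta is then
   obtained by applying iota o phi to the truncations of a null sequence. *)
Require Import Defs.
From HB Require Import structures.
From mathcomp Require Import all_boot all_order all_algebra.
From mathcomp Require Import finmap spectral complex.
From mathcomp Require Import all_classical all_reals all_analysis.
From mathcomp Require Import ring lra.

Set Implicit Arguments.
Unset Strict Implicit.
Unset Printing Implicit Defensive.

Import Order.TTheory GRing.Theory Num.Theory.
Import numFieldNormedType.Exports.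
Import Normc.

Local Open Scope classical_set_scope.
Local Open Scope ring_scope.
Local Open Scope complex_scope.

(** * Trace and operator norm estimates on one matrix block *)

(** For [k != j], the unit [E_jk] is [E_jj E_jk] while [E_jk E_jj = 0], so [f] kills it. All
    diagonal units have the same image because [E_jj = E_ji E_ij] and [E_ii = E_ij E_ji]. *)
Lemma tracial_linear_mxE (K : comNzRingType) (V : lmodType K) n
    (f : {linear 'M[K]_n -> V}) :
  (forall A B, f (A *m B) = f (B *m A)) ->
  forall (i : 'I_n) (A : 'M[K]_n), f A = \tr A *: f (delta_mx i i).
Proof.
move=> ftr i A; rewrite [in LHS](matrix_sum_delta A) linear_sum scaler_suml.
apply: eq_bigr => j _; rewrite linear_sum (bigD1 j)//= big1 ?addr0 => [|k kj].
  rewrite linearZ/=; congr (_ *: _).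
  by rewrite -(mul_delta_mx i j j) ftr mul_delta_mx.
rewrite linearZ/= -(mul_delta_mx j j k) ftr mul_delta_mx_cond (negbTE kj).
by rewrite mulr0n linear0 scaler0.
Qed.

Section FiniteMatrices.
Variable R : realType.
Local Notation C := R[i].
Local Open Scope sesquilinear_scope.

Lemma l2norm_sqrE n (v : 'cV[C]_n) : ((l2norm v) ^+ 2)%:C = (v^t* *m v) 0 0.
Proof. by rewrite rmorphXn/= l2normE sqrtCK dotmx_tr. Qed.

Lemma normc_dot_le n (u v : 'cV[C]_n) :
  normc ((u^t* *m v) 0 0) <= l2norm v * l2norm u.
Proof.
have : `|dotmx v^T u^T| <= (l2norm v)%:C * (l2norm u)%:C.
  rewrite (l2normE v) (l2normE u).
  exact: (CauchySchwarz_sqrt (dotmx (n:=_)) v^T u^T).1.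
by rewrite -[leRHS](rmorphM (real_complex R)) normcCE lecR dotmx_tr.
Qed.

(* The nontrivial half of the C*-identity *)
Lemma opnorm_sqr_le n (A : 'M[C]_n) : opnorm A ^+ 2 <= opnorm (A^t* *m A).
Proof.
set B := A^t* *m A.
have B0 : 0 <= opnorm B by apply: opnorm_ge0.
rewrite -[leRHS]sqr_sqrtr// ler_pXn2r ?nnegrE ?opnorm_ge0 ?sqrtr_ge0//.
apply: opnorm_le => [|v]; first exact: sqrtr_ge0.
rewrite -[l2norm v]ger0_norm ?l2norm_ge0// -sqrtr_sqr -sqrtrM//.
rewrite -[leLHS]ger0_norm ?l2norm_ge0// -sqrtr_sqr ler_wsqrtr//.
have -> : l2norm (A *m v) ^+ 2 = normc ((v^t* *m (B *m v)) 0 0).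
  apply: complexI; rewrite -normcCE.
  have -> : v^t* *m (B *m v) = (A *m v)^t* *m (A *m v).
    by rewrite trmx_mul map_mxM/= !mulmxA.
  by rewrite -l2norm_sqrE ger0_norm// lecR sqr_ge0.
apply: le_trans (normc_dot_le _ _) _.
by rewrite expr2 mulrA ler_wpM2r ?l2norm_ge0// opnormP.
Qed.

Section OneSet.
Variable F : finN.

Lemma basis_vec_dot (s t : label F) :
  (basis_vec R s)^t* *m basis_vec R t = ((s == t)%:R)%:M.
Proof.
rewrite /basis_vec trmx_delta map_delta_mx mul_delta_mx_cond.
rewrite (inj_eq enum_rank_inj).
by apply/matrixP => a b; rewrite !ord1 !mxE; case: eqP => _; rewrite !mxE ?eqxx.
Qed.

Lemma l2norm_xvec (j : val F) : l2norm (xvec R j) ^+ 2 = 3.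
Proof.
apply: complexI; rewrite [RHS](rmorph_nat (real_complex R) 3) l2norm_sqrE /xvec.
rewrite !raddfD/= !mulmxDl !basis_vec_dot.
by rewrite !eqxx/= !mxE/= !mulr1n !mulr0n !(addr0, add0r) -addrA.
Qed.

Lemma l2norm_yvec (j : val F) : l2norm (yvec R j) ^+ 2 = 3.
Proof.
apply: complexI; rewrite [RHS](rmorph_nat (real_complex R) 3) l2norm_sqrE /yvec.
rewrite !raddfD !raddfN/= !mulmxDl.
rewrite !mulNmx !basis_vec_dot.
rewrite !eqxx/= !mxE/= !mulr1n !mulr0n.
by rewrite !(oppr0, addr0, add0r) opprK -addrA.
Qed.

(** By cyclicity the trace is the inner product of [Y y_j] with [x_j], and Cauchy-Schwarz leaves the
    factor [sqrt 3 * sqrt 3]. *)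
Lemma normc_trace_Emx (j : val F) (Y : Mat R F) :
  normc (\tr (Emx R j *m Y)) <= 3 * opnorm Y.
Proof.
rewrite /Emx -mulmxA mxtrace_mulC -mulmxA /mxtrace big_ord1.
apply: le_trans (normc_dot_le _ _) _.
apply: le_trans (ler_wpM2r (l2norm_ge0 _) (opnormP _ _)) _.
rewrite -mulrA mulrC ler_wpM2r ?opnorm_ge0//.
suff -> : l2norm (yvec R j) = l2norm (xvec R j) by rewrite -expr2 l2norm_xvec.
by apply/eqP; rewrite -(eqrXn2 (n := 2)) ?l2norm_ge0// l2norm_yvec l2norm_xvec.
Qed.

Lemma normc_trace_phi_fam (a : l1 R) (s : R) (Y : Mat R F) :
  (forall n, normc (a n) <= s) ->
  normc (\tr (phi_fam a F *m Y)) <= #|{: val F}|%:R * (s * (3 * opnorm Y)).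
Proof.
move=> as_; rewrite /phi_fam mulmx_suml raddf_sum/=.
apply: (@le_trans _ _ (\sum_(j : val F) s * (3 * opnorm Y))); last first.
  by rewrite sumr_const [leRHS]mulr_natl.
elim/big_ind2: _ => [|x1 x2 y1 y2 h1 h2|j _].
- by rewrite normc0.
- by apply: le_trans (normcD _ _) _; apply: lerD.
rewrite -scalemxAl mxtraceZ normcM.
by rewrite ler_pM ?normc_ge0// normc_trace_Emx.
Qed.

End OneSet.
End FiniteMatrices.

Lemma finN_nonempty : [set: finN] !=set0.
Proof.
have F0 : [fset 0%N]%fset != (fset0 : {fset nat}).
  by apply/fset0Pn; exists 0%N; rewrite in_fset1.
by exists (exist (fun F : {fset nat} => is_true (F != fset0)) _ F0).
Qed.

(** * Involution and positive functionals on the product algebra *)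

Section ProductTraces.
Variable R : realType.
Local Notation C := R[i].
Local Notation M := (prodM R).
Local Open Scope sesquilinear_scope.

Lemma prodM_eqP (x y : M) : (forall F, x F = y F) -> x = y.
Proof. by move=> xy; apply/val_inj/functional_extensionality_dep. Qed.

Lemma component_sum (I : Type) (r : seq I) (f : I -> M) F :
  (\sum_(i <- r) f i) F = \sum_(i <- r) f i F.
Proof.
by elim: r => [|i r ih]; rewrite ?big_nil// !big_cons -ih.
Qed.

Lemma opnorm_component_le (x : M) F : opnorm (x F) <= prodM_norm x.
Proof.
apply: ub_le_sup; last by exists F.
case: x => x /= /bounded_famP[K xK]; exists K => _ [G _ <-]; exact: xK.
Qed.

Lemma starM (x y : M) : star (x * y) = star y * star x.
Proof. by apply: prodM_eqP => F; rewrite /component/= trmx_mul map_mxM. Qed.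

Lemma starD (x y : M) : star (x + y) = star x + star y.
Proof. by apply: prodM_eqP => F; rewrite /component/= !raddfD. Qed.

Lemma starZ (c : C) (x : M) : star (c *: x) = c^*%R *: star x.
Proof. by apply: prodM_eqP => F; rewrite /component/= linearZ/= map_mxZ. Qed.

Lemma starK (x : M) : star (star x) = x.
Proof. by apply: prodM_eqP => F; rewrite /component/= trmxCK. Qed.

Lemma star1 : star 1 = 1 :> M.
Proof. by apply: prodM_eqP => F; rewrite /component/= trmx1 map_mx1. Qed.

Section Positive.
Variable tau : {scalar M}.
Hypothesis tau_pos : forall x, 0 <= tau (star x * x).

(** A nonnegative complex number has zero imaginary part. At [1 + w] this relates the imaginary
    parts of the two sides, at [1 + 'i *: w] the real parts. *)
Lemma positive_star (w : M) : tau (star w) = (tau w)^*%R.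
Proof.
have := tau_pos 1; rewrite star1 mul1r.
have := tau_pos w; have := tau_pos (1 + 'i *: w); have := tau_pos (1 + w).
rewrite !starD !starZ star1 !mulrDl !mulrDr !mul1r !mulr1 -!scalerAl -!scalerAr.
rewrite !linearD/= !linearZ/=.
case: (tau w) => a b; case: (tau (star w)) => c d.
case: (tau 1) => e f; case: (tau (star w * w)) => g h.
rewrite !lecE/= => /andP[/eqP h1 _] /andP[/eqP h2 _] /andP[/eqP h3 _] /andP[/eqP h4 _].
by congr (_ +i* _); lra.
Qed.

(* Cauchy-Schwarz, in the additive form that avoids square roots *)
Lemma positive_cauchy_schwarz (t : R) (q x : M) : 0 < t ->
  2 * t * normc (tau (star q * x)) <=
  t ^+ 2 * complex.Re (tau (star q * q)) + complex.Re (tau (star x * x)).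
Proof.
move=> t0; set c := tau (star q * x).
have [c0|c0] := eqVneq c 0.
  have := tau_pos q; have := tau_pos x; rewrite !lecE => /andP[_ x0] /andP[_ q0].
  by rewrite c0 normc0 mulr0 addr_ge0// mulr_ge0// sqr_ge0.
(* A unimodular scalar with [l * c = - |c|]: positivity at [t q + l x] then has the cross term
   [- 2 t |c|]. *)
pose l : C := - (c^*%R / `|c|).
have lc : l * c = - `|c|.
  rewrite /l mulNr mulrAC [c^*%R * c]mulrC -normCK expr2 mulfK//.
  by rewrite normr_eq0.
have ll : l^*%R * l = 1.
  rewrite mulrC -normCK /l normrN normf_div norm_conjC normr_id divff ?expr1n//.
  by rewrite normr_eq0.
have h := tau_pos (t%:C *: q + l *: x).
have tC : (t%:C)^*%R = t%:C by apply: conj_Creal; rewrite ger0_real// lecR ltW.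
rewrite starD !starZ tC !mulrDl !mulrDr -!scalerAl -!scalerAr !scalerA in h.
rewrite !linearD/= !linearZ/= ll mul1r in h.
have qx : tau (star x * q) = c^*%R by rewrite -positive_star starM starK.
rewrite -/c -[t%:C * l * c]mulrA lc qx in h.
have lqx : l^*%R * t%:C * c^*%R = - (t%:C * `|c|).
  rewrite [l^*%R * _]mulrC -mulrA -rmorphM/= lc rmorphN/= mulrN; congr (- (_ * _)).
  by apply: conj_Creal; rewrite normr_real.
rewrite lqx normcCE in h; move: h.
case: (tau (star q * q)) => a b; case: (tau (star x * x)) => d e.
rewrite lecE => /andP[_ h]; rewrite /= in h.
change (2 * t * normc c <= t ^+ 2 * a + d); lra.
Qed.

End Positive.

(** * Cut-offs to finitely many blocks *)

Section Blocks.

Lemma block_subproof F (A : Mat R F) :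
  (eqtype.dfwith (0 : matfam R) A : matfam R) \in @bounded_fam R.
Proof.
apply/bounded_famP; exists (opnorm A) => G.
case: (eqVneq F G) => [<-|FG]; first by rewrite dfwith_in.
by rewrite dfwith_out//; apply: opnorm_le => [|v];
  rewrite ?mul0mx ?l2norm0 ?mulr_ge0 ?l2norm_ge0 ?opnorm_ge0.
Qed.

Definition block F (A : Mat R F) : M := ProdM (block_subproof A).

Lemma block_in F (A : Mat R F) : block A F = A.
Proof. exact: dfwith_in. Qed.

Lemma block_out F G (A : Mat R F) : F != G -> block A G = 0.
Proof. by move=> FG; rewrite /component/= dfwith_out. Qed.

Lemma block_linear F : linear (@block F).
Proof.
move=> c A B; apply: prodM_eqP => G.
rewrite [RHS](_ : _ = c *: block A G + block B G)//.
case: (eqVneq F G) => [<-|FG]; first by rewrite !block_in.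
by rewrite !block_out// scaler0 addr0.
Qed.

HB.instance Definition _ F :=
  GRing.isLinear.Build C (Mat R F) M _ (@block F) (@block_linear F).

Lemma block_mul F (A : Mat R F) (x : M) : block A * x = block (A *m x F).
Proof.
apply: prodM_eqP => G; rewrite [LHS](_ : _ = block A G *m x G)//.
case: (eqVneq F G) => [<-|FG]; first by rewrite !block_in.
by rewrite !block_out// mul0mx.
Qed.

Lemma star_block F (A : Mat R F) : star (block A) = block (A^t*).
Proof.
apply: prodM_eqP => G; rewrite [LHS](_ : _ = (block A G)^t*)//.
case: (eqVneq F G) => [<-|FG]; first by rewrite !block_in.
by rewrite !block_out// !raddf0.
Qed.

(** The central projection onto the factors indexed by [G]. *)
Definition blocks (G : {fset finN}) : M := \sum_(F <- G) block (1%:M : Mat R F).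

Lemma component_blocks G F : blocks G F = if F \in G then 1%:M else 0.
Proof.
rewrite component_sum; case: ifPn => FG.
  rewrite (big_rem F FG) block_in big_seq big1 => [|H]; first exact: addr0.
  by rewrite mem_rem_uniq ?fset_uniq// inE => /andP[HF _]; rewrite block_out.
rewrite big_seq big1// => H HG; rewrite block_out//.
by apply: contra FG => /eqP <-.
Qed.

Lemma star_blocks G : star (blocks G) = blocks G.
Proof.
apply: prodM_eqP => F; rewrite [LHS](_ : _ = (blocks G F)^t*)//.
by rewrite component_blocks; case: ifP => _; rewrite ?trmx1 ?map_mx1 ?raddf0.
Qed.

Lemma blocks_mul G (x : M) : blocks G * x = \sum_(F <- G) block (x F).
Proof.
by rewrite mulr_suml; apply: eq_bigr => F _; rewrite block_mul mul1mx.
Qed.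

(** The difference of nested projections is a projection, hence its own square root. *)
Lemma leM_blocks G H : (G `<=` H)%fset -> leM (blocks G) (blocks H).
Proof.
move=> GH; exists (blocks H - blocks G); apply: prodM_eqP => F.
rewrite [RHS](_ : _ = (blocks H F - blocks G F)^t* *m (blocks H F - blocks G F))//.
rewrite [LHS](_ : _ = blocks H F - blocks G F)// !component_blocks.
have [FG|FG] := boolP (F \in G); first by rewrite (fsubsetP GH)// subrr mulmx0.
by case: ifP; rewrite subr0 ?mulmx0// mulmx1 trmx1 map_mx1.
Qed.

(** This form makes [tau (1 - blocks G)] nonnegative and lets [1 - blocks G] serve as [q] in
    Cauchy-Schwarz. *)
Lemma sub_blocks_sqr G : star (1 - blocks G) * (1 - blocks G) = 1 - blocks G.
Proof.
apply: prodM_eqP => F.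
rewrite [LHS](_ : _ = (1%:M - blocks G F)^t* *m (1%:M - blocks G F))//.
rewrite [RHS](_ : _ = 1%:M - blocks G F)// !component_blocks.
by case: ifP; rewrite ?subrr ?mulmx0// subr0 mulmx1 trmx1 map_mx1.
Qed.

(* The square root of u - 1 in each block is bounded by the C*-inequality, so
   these blockwise roots assemble into an element of M. *)
Lemma lubM_blocks : lubM (range blocks) 1.
Proof.
split=> [_ [G _ <-]|u uG].
  by exists (1 - blocks G); rewrite sub_blocks_sqr.
have /choice[z uz] : forall F, exists z : M, u F - 1%:M = (z F)^t* *m z F.
  (* The upper bound is tested on the singleton [{F}], whose cut-off is the identity in block
     [F]. *)
  move=> F; have [|z uz] := uG (blocks [fset F]%fset); first by exists [fset F]%fset.
  exists z; have := congr1 (fun w : M => w F) uz.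
  rewrite [LHS](_ : _ = u F - blocks [fset F]%fset F)//.
  by rewrite component_blocks in_fset1 eqxx.
have zb : (fun F => z F F : Mat R F) \in @bounded_fam R.
  (* With [p] the norm of the root and [r] that of [u - 1], [p ^+ 2 <= r] forces [p <= 1 + r]. *)
  apply/bounded_famP; exists (1 + prodM_norm (u - 1)) => F.
  have := opnorm_sqr_le (z F F); rewrite -uz.
  have := opnorm_component_le (u - 1) F.
  rewrite [X in opnorm X <= _ -> _](_ : _ = u F - 1%:M)//.
  have := opnorm_ge0 (z F F); have := opnorm_ge0 (u F - 1%:M).
  set p := opnorm (z F F); set s := opnorm _; set r := prodM_norm _.
  nra.
exists (ProdM zb); apply: prodM_eqP => F; exact: uz.
Qed.

End Blocks.

(** * Normal tracial states as weighted sums of matrix traces *)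

Section NormalTrace.
Variable tau : {scalar M}.
Hypotheses (tau_state : is_state tau) (tau_normal : is_normal tau).

Let tau_pos x : 0 <= tau (star x * x). Proof. by have [] := tau_state. Qed.

(** Normality enters here: if every complement had trace at least [e], then [1 - e] would bound all
    [tau (blocks G)], whose supremum is [tau 1 = 1]. *)
Lemma tau_sub_blocks_small (e : R) : 0 < e ->
  exists G, complex.Re (tau (1 - blocks G)) < e.
Proof.
move=> e0; have [||||_ lb] := tau_normal (D := range blocks) (s := 1).
- by exists (blocks fset0); exists fset0.
- by move=> _ [G _ <-]; rewrite star_blocks.
- move=> _ _ [G _ <-] [H _ <-]; exists (blocks (G `|` H)%fset); split.
  + by exists (G `|` H)%fset.
  + by apply: leM_blocks; apply: fsubsetUl.
  + by apply: leM_blocks; apply: fsubsetUr.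
- exact: lubM_blocks.
have t1 : tau 1 = 1 by have [] := tau_state.
apply: contrapT => /forallNP small.
have : tau 1 <= (1 - e)%:C.
  apply: lb => _ [_ [G _ <-] <-].
  have := tau_pos (1 - blocks G); have /negP := small G.
  rewrite sub_blocks_sqr linearB/= t1 -leNgt.
  case: (tau (blocks G)) => a b; rewrite !lecE/= => h /andP[/eqP h1 h2].
  by apply/andP; split; [apply/eqP|]; lra.
by rewrite t1 lecR => h; lra.
Qed.

(** The remainder [(1 - blocks G) * x] has arbitrarily small trace, by Cauchy-Schwarz against the
    small projection [1 - blocks G]. *)
Lemma normc_normal_le (x : M) (b : R) :
  (forall G, normc (tau (blocks G * x)) <= b) -> normc (tau x) <= b.
Proof.
move=> xb; apply/ler_addgt0Pr => e e0.
set B := complex.Re (tau (star x * x)).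
have B0 : 0 <= B by have := tau_pos x; rewrite lecE => /andP[].
(* With [t = (B + 1) / e], this threshold makes [t ^+ 2 * A <= B + 1]. Cauchy-Schwarz then gives
   [2 t n <= 2 B + 1 < 2 t e], so [n <= e]. The [+ 1] covers [B = 0]. *)
have [|G sG] := @tau_sub_blocks_small (e ^+ 2 / (B + 1)).
  by rewrite divr_gt0 ?exprn_gt0// ltr_wpDl.
have t0 : 0 < (B + 1) / e by rewrite divr_gt0// ltr_wpDl.
have := positive_cauchy_schwarz tau_pos (1 - blocks G) x t0.
rewrite sub_blocks_sqr -/B => h.
have sE : star (1 - blocks G) = 1 - blocks G.
  by rewrite -{1}sub_blocks_sqr starM starK sub_blocks_sqr.
rewrite sE in h.
have -> : x = blocks G * x + (1 - blocks G) * x by rewrite -mulrDl addrC subrK mul1r.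
rewrite linearD/=; apply: le_trans (normcD _ _) _; apply: lerD => //.
move: sG h t0; set A := complex.Re _; set n := normc _; set t := (B + 1) / e => sG h t0.
have At : t ^+ 2 * A <= B + 1.
  apply: le_trans (ler_wpM2l (sqr_ge0 _) (ltW sG)) _.
  rewrite /t le_eqVlt; apply/orP; left; apply/eqP; field.
  by rewrite !gt_eqF// ltr_wpDl.
have te : t * e = B + 1 by rewrite /t mulfVK// gt_eqF.
rewrite -(ler_pM2l t0) te; lra.
Qed.

Hypothesis tau_tracial : is_tracial tau.

(** On one block [tau] is a tracial functional, hence a multiple of the matrix trace. The multiple
    is its value at a rank-one projection, nonnegative by positivity; the index [lalpha F] is an
    arbitrary choice. *)
Lemma tau_blockE F : exists2 c : R, 0 <= c &
  forall A : Mat R F, tau (block A) = c%:C * \tr A.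
Proof.
pose i := enum_rank (lalpha F).
pose E : Mat R F := delta_mx i i.
have EE : star (block E) * block E = block E.
  by rewrite star_block block_mul block_in /E trmx_delta map_delta_mx mul_delta_mx.
have := tau_pos (block E); rewrite EE => p.
exists (complex.Re (tau (block E))) => [|A]; first by move: p; rewrite lecE => /andP[].
have tr X Y : (tau \o @block F) (X *m Y) = (tau \o @block F) (Y *m X).
  rewrite /= -{1}[Y]block_in -{2}[X]block_in -!block_mul; exact: tau_tracial.
rewrite [LHS](tracial_linear_mxE tr i A)/= mulrC; congr (_ * _).
move: p; rewrite -/E; case: (tau _) => a b.
by rewrite lecE/= => /andP[/eqP -> _].
Qed.

(** Block [F] has mass [c_F * #|label F|], so it contributes at most its mass times [b]. The masses
    over [G] add up to [tau (blocks G) <= 1]. *)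
Lemma normc_tracial_le (x : M) (b : R) :
  (forall F, normc (\tr (x F)) <= #|label F|%:R * b) -> normc (tau x) <= b.
Proof.
move=> xb; apply: normc_normal_le => G.
have b0 : 0 <= b.
  have [F _] := finN_nonempty.
  have := le_trans (normc_ge0 _) (xb F).
  by rewrite pmulr_rge0// ltr0n; apply/card_gt0P; exists None.
apply: (@le_trans _ _ (complex.Re (tau (blocks G)) * b)); last first.
  apply: ler_piMl => //.
  have := tau_pos (1 - blocks G); rewrite sub_blocks_sqr linearB/= tau_state.2.
  by case: (tau _) => c d; rewrite lecE/= subr_ge0 => /andP[].
have -> : complex.Re (tau (blocks G)) =
    \sum_(F <- G) complex.Re (tau (block (1%:M : Mat R F))).
  rewrite linear_sum; exact: raddf_sum.
rewrite blocks_mul linear_sum mulr_suml.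
elim/big_ind2: _ => [|x1 x2 y1 y2 h1 h2|F _].
- by rewrite normc0.
- by apply: le_trans (normcD _ _) _; apply: lerD.
have [c c0 cE] := tau_blockE F.
have cn : normc c%:C = c by apply: complexI; rewrite -normcCE ger0_norm// lecR.
have -> : complex.Re (tau (block (1%:M : Mat R F))) = c * #|label F|%:R.
  by rewrite cE mxtrace1 -[_%:R](rmorph_nat (real_complex R)) -rmorphM.
rewrite cE normcM cn.
by rewrite -mulrA ler_wpM2l.
Qed.

End NormalTrace.
End ProductTraces.

(** * Truncations of sequences in l1 and c0 *)

Section Sequences.
Variable R : realType.
Local Notation C := R[i].

Lemma sup_norm_le (a : nat -> C) (b : R) :
  (forall n, normc (a n) <= b) -> sup_norm a <= b.
Proof.
by move=> ab; apply: ge_sup => [|_ [n _ <-]//]; exists (normc (a 0%N)); exists 0%N.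
Qed.

Lemma normc_le_sup_norm (a : c0 R) n : normc (a n) <= sup_norm a.
Proof.
apply: ub_le_sup; last by exists n.
case: a => a /= /vanishingP /cvgP /cvg_seq_bounded [M [_ /(_ (M + 1))]].
rewrite ltrDl ltr01 => /(_ isT) aM; exists (M + 1) => _ [m _ <-].
by have := aM m I; rewrite /= ger0_norm ?normc_ge0.
Qed.

Lemma l1_sumE (I : Type) (r : seq I) (f : I -> l1 R) n :
  (\sum_(i <- r) f i : l1 R) n = \sum_(i <- r) f i n.
Proof. by elim: r => [|i r ih]; rewrite ?big_nil// !big_cons -ih. Qed.

(** As a finite combination of unit sequences it lies in l1 for every [a], and linear maps on it are
    determined by their values at [l1_delta]. *)
Definition truncate (N : nat) (a : nat -> C) : l1 R :=
  \sum_(j < N) a j *: l1_delta R j.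

Lemma truncateE N (a : nat -> C) n : truncate N a n = if (n < N)%N then a n else 0.
Proof.
rewrite l1_sumE (eq_bigr (fun j : 'I_N => a j * (n == j)%:R))//.
case: ltnP => nN.
  rewrite (bigD1 (Ordinal nN))//= eqxx mulr1 big1 ?addr0// => j jn.
  rewrite (_ : (n == j) = false) ?mulr0//.
  by apply/negbTE; apply: contra jn => /eqP e; apply/eqP/val_inj.
rewrite big1// => j _; rewrite gtn_eqF ?mulr0//.
exact: leq_trans (ltn_ord j) nN.
Qed.

Lemma truncate_linear N c (a b : nat -> C) :
  truncate N (c *: a + b) = c *: truncate N a + truncate N b.
Proof.
rewrite /truncate scaler_sumr -big_split/=; apply: eq_bigr => j _.
by rewrite scalerA -scalerDl.
Qed.

(** The norm of the tail is the total sum minus the [N]-th partial sum. *)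
Lemma l1_norm_truncate_cvg (a : l1 R) :
  l1_norm (a - truncate N a) @[N --> \oo] --> (0 : R).
Proof.
have sa : cvgn (series (fun n => normc (a n))).
  by case: a => a /= /absolutely_summableP.
rewrite [X in X @ _](_ : _ = fun N => l1_norm a - series (fun n => normc (a n)) N).
  rewrite -(subrr (l1_norm a)); apply: cvgB; [exact: cvg_cst|exact: sa].
apply/funext => N; apply: cvg_lim => //; set b := a - _.
have bE i : b i = if (i < N)%N then 0 else a i.
  rewrite (_ : b i = a i - truncate N a i)// truncateE.
  by case: ifP; rewrite ?subrr ?subr0.
clearbody b.
have : series (fun n => normc (a n)) n - series (fun n => normc (a n)) N @[n --> \oo]
    --> l1_norm a - series (fun n => normc (a n)) N.
  by apply: cvgB; [exact: sa|exact: cvg_cst].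
apply: cvg_trans; apply: near_eq_cvg; near=> n.
have Nn : (N <= n)%N by near: n; exists N.
rewrite /series/= (big_cat_nat (n := N))//= addrAC subrr add0r.
rewrite [in RHS](big_cat_nat (n := N))//= [X in _ = X + _]big_nat.
rewrite [X in _ = X + _]big1 ?add0r => [|i iN]; last by rewrite bE (andP iN).2 normc0.
by apply: eq_big_nat => i /andP[Ni _]; rewrite bE ltnNge Ni.
Unshelve. all: by end_near.
Qed.

(** The first estimate makes images of truncations Cauchy; the second identifies their limit when
    [f] comes from l1. *)
Lemma vanishing_truncate (f : c0 R) (e : R) : 0 < e ->
  exists N0, forall M N, (N0 <= M)%N -> (N0 <= N)%N ->
    sup_norm (truncate M f - truncate N f) <= e /\
    sup_norm ((f : nat -> C) - truncate N f) <= e.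
Proof.
move=> e0.
have [N0 _ fe] : \forall n \near \oo, normc (f n) < e.
  have /vanishingP/cvgr_lt : (f : nat -> C) \in @vanishing R by case: f.
  exact.
have small N n : (N0 <= N)%N -> normc (f n - truncate N f n) <= e.
  move=> N0N; rewrite truncateE; case: ltnP => nN; first by rewrite subrr normc0 ltW.
  by rewrite subr0 ltW//; apply: fe; apply: leq_trans nN.
exists N0 => M N N0M N0N; split; apply: sup_norm_le => n; last exact: small.
rewrite [X in normc X](_ : _ = truncate M f n - truncate N f n)// !truncateE.
case: ltnP => nM; case: ltnP => nN; rewrite ?subrr ?subr0 ?sub0r ?normcN ?normc0 ?(ltW e0)//.
- by rewrite ltW//; apply: fe; apply: leq_trans nN.
- by rewrite ltW//; apply: fe; apply: leq_trans nM.
Qed.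

End Sequences.

(** * The homomorphism phi and its L1 bound *)

Section Phi.
Variable R : realType.
Local Notation C := R[i].

Lemma opnorm_eq0 n (A : 'M[C]_n) : opnorm A <= 0 -> A = 0.
Proof.
move=> A0; apply/matrixP => i j.
have /l2norm_eq0/colP/(_ i) : l2norm (A *m delta_mx j (0 : 'I_1)) = 0.
  apply/le_anti; rewrite l2norm_ge0 andbT; apply: le_trans (opnormP _ _) _.
  by rewrite mulr_le0_ge0 ?l2norm_ge0.
by rewrite -colE !mxE.
Qed.

Lemma phi0_delta_in (F : finN) (j : nat) (jF : j \in val F) :
  phi0 (l1_delta R j) F = Emx R [` jF]%fset.
Proof.
rewrite [LHS](_ : _ = phi_fam (l1_delta R j) F)// /phi_fam.
rewrite (bigD1 [` jF]%fset)//= eqxx scale1r big1 ?addr0// => k kj.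
rewrite (_ : (val k == j) = false) ?scale0r//.
by apply/negbTE; apply: contra kj => /eqP e; apply/eqP/val_inj.
Qed.

Lemma phi0_delta_out (F : finN) (j : nat) : j \notin val F ->
  phi0 (l1_delta R j) F = 0.
Proof.
move=> jF; rewrite [LHS](_ : _ = phi_fam (l1_delta R j) F)// /phi_fam.
rewrite big1// => k _ /=; rewrite (_ : (val k == j) = false) ?scale0r//.
by apply/negbTE; apply: contra jF => /eqP <-; apply: valP.
Qed.

(** This gives any such [phi] the explicit formula [phi_fam]: both maps agree on truncations, which
    are dense in l1, and both are bounded. *)
Lemma phi_unique (phi : {linear l1 R -> prodM R})
    (phi_bounded : exists K : R,
      forall a : l1 R, prodM_norm (phi a) <= K * l1_norm a)
    (phi_delta_in : forall (F : finN) (j : nat) (jF : j \in val F),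
      phi (l1_delta R j) F = Emx R [` jF]%fset)
    (phi_delta_out : forall (F : finN) (j : nat), j \notin val F ->
      phi (l1_delta R j) F = 0) (a : l1 R) : phi a = phi0 a.
Proof.
have [K phiK] := phi_bounded.
have delta j : phi (l1_delta R j) = phi0 (l1_delta R j).
  apply: prodM_eqP => F; have [jF|jF] := boolP (j \in val F).
    by rewrite phi_delta_in phi0_delta_in.
  by rewrite phi_delta_out// phi0_delta_out.
have trunc N : phi (truncate N a) = phi0 (truncate N a).
  rewrite /truncate !linear_sum; apply: eq_bigr => j _.
  by rewrite !linearZ/= delta.
apply: prodM_eqP => F; apply/eqP; rewrite -subr_eq0; apply/eqP/opnorm_eq0.
(* [K] bounds [phi], and 9 is the constant of [phi_fam_bound]. *)
have bound N : opnorm ((phi a - phi0 a) F) <= (K + 9) * l1_norm (a - truncate N a).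
  have -> : (phi a - phi0 a) F =
      phi (a - truncate N a) F + (-1) *: phi0 (a - truncate N a) F.
    rewrite scaleN1r; apply: (congr1 (fun w : prodM R => w F) (y := _ - _)).
    by rewrite (linearB phi) (linearB (@phi0 R)) trunc opprB addrA subrK.
  rewrite mulrDl; apply: le_trans (opnormD _ _) _; apply: lerD.
    exact: le_trans (opnorm_component_le _ _) (phiK _).
  apply: le_trans (opnormZ _ _) _; rewrite normcN normc1 mul1r.
  exact: phi_fam_bound.
have : (K + 9) * l1_norm (a - truncate N a) @[N --> \oo] --> (K + 9) * 0.
  by apply: cvgMr; apply: l1_norm_truncate_cvg.
rewrite mulr0 => h; rewrite -(cvg_lim _ h)//.
by apply: limr_ge; [exact: cvgP h|exact: nearW].
Qed.

Lemma L1norm_phi_le (phi : {linear l1 R -> prodM R})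
    (tau : {scalar prodM R}) (phiE : forall a, phi a = phi0 a) :
  is_state tau -> is_normal tau -> is_tracial tau ->
  forall a : l1 R, L1norm tau (phi a) <= 3 * sup_norm a.
Proof.
move=> tau_state tau_normal tau_tracial a; rewrite phiE.
have as_ n : normc (a n) <= sup_norm a by have := normc_le_sup_norm (gelfand a) n.
have s0 : 0 <= sup_norm a := le_trans (normc_ge0 _) (as_ 0%N).
apply: ge_sup => [|_ [y /= y1 <-]].
  (* The element 0 of the unit ball shows that the supremum is over a nonempty set. *)
  exists (normc (tau (phi0 a * 0))); exists 0 => //=.
  apply: ge_sup => [|_ [F _ <-]].
    by have [F _] := finN_nonempty; exists (opnorm ((0 : prodM R) F)); exists F.
  by apply: opnorm_le => // v; rewrite mul0mx l2norm0 mul1r l2norm_ge0.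
apply: normc_tracial_le => // F.
rewrite [X in \tr X](_ : _ = phi_fam a F *m y F)//.
apply: le_trans (normc_trace_phi_fam _ as_) _.
apply: ler_pM => //; first by rewrite !mulr_ge0// opnorm_ge0.
  (* The labels alpha and omega make [label F] larger than [F] by two. *)
  by rewrite ler_nat !card_option !leqW.
rewrite mulrCA ler_wpM2l// ler_piMr//.
exact: le_trans (opnorm_component_le _ _) y1.
Qed.

End Phi.

(** * Extension of sup-norm bounded maps from l1 to c0 *)

Section Extension.
Variables (R : realType) (L : completeNormedModType R[i]).
Variable u : {linear l1 R -> L}.
Variable K : R.
Hypothesis u_le : forall a : l1 R, `|u a| <= (K * sup_norm a)%:C.
Hypothesis K0 : 0 < K.

Let part (f : c0 R) (N : nat) : L := u (truncate N f).

Let part_small (f : c0 R) (e : R[i]) : 0 < e ->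
  exists N0, forall M N, (N0 <= M)%N -> (N0 <= N)%N ->
    `|part f M - part f N| < e /\
    (K * sup_norm ((f : nat -> R[i]) - truncate N f))%:C < e.
Proof.
(* The norm of [L] is valued in [R[i]]; a positive element there is real. *)
case: e => e e'; rewrite ltcE/= => /andP[/eqP -> e0].
(* Halving [e] turns the weak bound into a strict one. *)
have [|N0 fe] := @vanishing_truncate R f (e / 2 / K).
  by rewrite !divr_gt0.
have lt x : x <= e / 2 / K -> (K * x)%:C < e%:C.
  move=> xe; rewrite ltcR; apply: le_lt_trans (_ : e / 2 < e); last by lra.
  by rewrite mulrC -ler_pdivlMr.
exists N0 => M N N0M N0N; have [h1 h2] := fe M N N0M N0N; split; last exact: lt.
by rewrite /part -linearB; apply: le_lt_trans (u_le _) _; apply: lt.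
Qed.

Let part_cvg (f : c0 R) : cvgn (part f).
Proof.
(* Completeness of [L] is used here. *)
apply/cauchy_cvgP/cauchy_exP => e e0; have [N0 fe] := part_small f e0.
exists (part f N0); exists N0 => // N /= N0N; rewrite -ball_normE /=.
by have [] := fe N0 N (leqnn _) N0N.
Qed.

Definition c0_extension (f : c0 R) : L := limn (fun N => u (truncate N f)).

Lemma c0_extension_linear : linear c0_extension.
Proof.
move=> c f g; apply: cvg_lim => //.
rewrite [X in X @ _](_ : _ = fun N => c *: part f N + part g N).
  by apply: cvgD; [apply: cvgZr; exact: part_cvg|exact: part_cvg].
by apply/funext => N; rewrite truncate_linear linearP.
Qed.

HB.instance Definition _ :=
  GRing.isLinear.Build R[i] (c0 R) L _ c0_extension c0_extension_linear.

Lemma c0_extension_gelfand (a : l1 R) : c0_extension (gelfand a) = u a.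
Proof.
apply: cvg_lim => //; apply/cvgrPdist_lt => e e0.
have [N0 fe] := part_small (gelfand a) e0.
exists N0 => // N /= N0N; have [_] := fe N N N0N N0N.
by apply: le_lt_trans; rewrite -linearB; exact: u_le.
Qed.

Lemma c0_extension_le (f : c0 R) : `|c0_extension f| <= (K * sup_norm f)%:C.
Proof.
have uf N : `|part f N| <= (K * sup_norm f)%:C.
  (* Truncating does not increase the sup norm, so the bound is uniform in [N] and passes to the
     limit. *)
  apply: le_trans (u_le _) _; rewrite lecR ler_pM2l//; apply: sup_norm_le => n.
  rewrite truncateE; case: ifP => _; first exact: normc_le_sup_norm.
  by rewrite normc0; apply: le_trans (normc_ge0 _) (normc_le_sup_norm f 0%N).
have nE : `|c0_extension f| = (complex.Re `|c0_extension f|)%:C.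
  by have := normr_ge0 (c0_extension f);
    case: `|_| => x y; rewrite lecE/= => /andP[/eqP -> _].
rewrite nE lecR; apply/ler_addgt0Pr => e e0; rewrite -lecR -nE rmorphD/=.
have /cvgrPdist_lt /(_ e%:C) := @part_cvg f; rewrite ltcR.
move=> /(_ e0) [N _ /(_ N (leqnn _))] h.
rewrite -[c0_extension f](subrK (part f N)) addrC.
apply: le_trans (ler_normD _ _) _; apply: lerD => //; exact: ltW.
Qed.

Lemma c0_extension_exists : exists theta : {linear c0 R -> L},
  (forall f : c0 R, `|theta f| <= (K * sup_norm f)%:C) /\
  (forall a : l1 R, theta (gelfand a) = u a).
Proof.
exists c0_extension; split; [exact: c0_extension_le|exact: c0_extension_gelfand].
Qed.

End Extension.

Theorem proposition5p2 (R : realType)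
  (phi : {linear l1 R -> prodM R})
  (phi_mul : forall a b : l1 R, phi (l1_mul a b) = phi a * phi b)
  (phi_bounded : exists K : R,
    forall a : l1 R, prodM_norm (phi a) <= K * l1_norm a)
  (phi_delta_in : forall (F : finN) (j : nat) (jF : j \in val F),
    phi (l1_delta R j) F = Emx R [` jF]%fset)
  (phi_delta_out : forall (F : finN) (j : nat), j \notin val F ->
    phi (l1_delta R j) F = 0)
  (tau : {scalar prodM R})
  (tau_state : is_state tau)
  (tau_faithful : is_faithful tau)
  (tau_normal : is_normal tau)
  (tau_tracial : is_tracial tau) :
  (forall a : l1 R, L1norm tau (phi a) <= 3 * sup_norm a) /\
  forall (L : completeNormedModType R[i]) (iota : {linear prodM R -> L}),
    L1_completion tau iota ->
    exists theta : {linear c0 R -> L},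
      (exists K : R, forall f : c0 R, `|theta f| <= (K * sup_norm f)%:C) /\
      (forall a : l1 R, theta (gelfand a) = iota (phi a)).
Proof.
have phi_le : forall a : l1 R, L1norm tau (phi a) <= 3 * sup_norm a.
  by apply: L1norm_phi_le => // a; apply: phi_unique.
split=> // L iota [iota_norm _].
(* Since [iota] is isometric for [L1norm], the trace estimate is the hypothesis of the extension
   with constant 3. *)
have u_le (a : l1 R) : `|(iota \o phi) a| <= (3 * sup_norm a)%:C.
  by rewrite iota_norm lecR.
have [theta [theta_le thetaE]] :=
  c0_extension_exists (u := iota \o phi) u_le (ltr0n R 3).
by exists theta; split; [exists 3|].
Qed.
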